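(* Let the convex problem data $(f,G)$ satisfy $\mathcal S^\star\neq\emptyset$ and metric subregularity, and let an algorithm satisfy the subdifferential-rate conditions with a positive definite matrix $P$ and constants $\gamma,\tau>0$ (all spelled out in the context). Let $z^k$ be its iterates from an initial point $z^0$, converging to $z^\star\in\mathcal S^\star$, and let $\mathcal M$, $\mathcal D_\delta$, $\alpha_{\mathcal M}$ be as in the context. Suppose there is an integer $K>0$ such that $z^k\in\mathcal D_\delta\cap\mathcal M$ for all $k>K$. Then, for all integers $k\ge1$, $$\operatorname{dist}_2(z^{k+K},\mathcal S^\star)\le\sqrt e\,\nu_{\mathcal M}\exp\left(-\frac12\,\frac{k}{\lceil e\,\nu_{\mathcal M}^2\rceil}\right)\operatorname{dist}_2(z^K,\mathcal S^\star),\qquad \nu_{\mathcal M}=\frac{\gamma\,\lambda_{\max}(P)}{\alpha_{\mathcal M}}.$$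
   Context: **Problem.** $f,g_1,\dots,g_m:\mathbb R^n\to\mathbb R$ are convex, $G(x)=(g_1(x),\dots,g_m(x))$, and $h(y)=\inf_{x\in\mathbb R^n}\{f(x)+\langle y,G(x)\rangle\}$. Write $z=(x,y)\in\mathbb R^n\times\mathbb R^m$. $\mathcal S^\star$ is the set of primal-dual solutions of $\min f$ s.t. $G\le0$: all $(x,y)$ with $f(x)-h(y)\le 0$, $G(x)\le 0$, $y\ge 0$. The saddle subdifferential of $\mathcal L(x,y)=f(x)-\iota_{\mathbb R^m_+}(y)+\langle y,G(x)\rangle$ is $\mathcal F(z)=\partial_x\mathcal L(x,y)\times\partial_y(-\mathcal L)(x,y)$, i.e. $\mathcal F(x,y)=\big(\partial f(x)+\sum_j y_j\partial g_j(x)\big)\times\big(-G(x)+N_{\mathbb R^m_+}(y)\big)$ if $y\ge0$ and $\emptyset$ otherwise ($N_{\mathbb R^m_+}$ is the normal cone). **Norms.** For positive definite $M$, $\|z\|_M=\sqrt{z^\top Mz}$, $\operatorname{dist}_M(z,Q)=\inf_{q\in Q}\|z-q\|_M$ ($+\infty$ if $Q=\emptyset$); $\operatorname{dist}_2$ is Euclidean distance; $\mathbf B^P_t(z)$ is the open $\|\cdot\|_P$-ball of radius $t$; $\mathbf B$ is the open Euclidean unit ball. $\lambda_{\max}(P)$ is the largest eigenvalue. **Metric subregularity.** For every $t>0$ there is $\alpha>0$ with $\alpha\operatorname{dist}_2(z,\mathcal S^\star)\le\operatorname{dist}_2(0,\mathcal F(z))$ for all $z\in\mathcal S^\star+t\mathbf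 B$. **Algorithm.** A rule $(z^{k+1},\tilde z^{k+1})=\mathtt{PrimalDualStep}(z^k)$, $k\ge0$, which from any $z^0\in\mathbb R^{n+m}$ generates main iterates $z^k$ and auxiliary iterates $\tilde z^k$. *Subdifferential-rate conditions*: (i) there is $\gamma>0$ such that, for every initial iterate $z^0$, $\operatorname{dist}_{P^{-1}}(0,\mathcal F(z^k))\le \gamma\operatorname{dist}_P(z^0,\mathcal S^\star)/\sqrt k$ for all $k\ge1$; (ii) for the run considered there is $\tau>0$ with $\operatorname{dist}_2(z^k,\mathcal S^\star)\le\tau$ for all $k\ge1$. **Sets and constants.** With $z^\star=(x^\star,y^\star)$: $N=\{j:g_j(x^\star)<0\}$, $B_a=\{j:g_j(x^\star)=0,\ y^\star_j>0\}$, $\mathcal M=\{(x,y)\in\mathbb R^n\times\mathbb R^m_+: G(x)_N<0,\ y_N=0,\ y_{B_a}>0\}$, $\delta=\sup\{t\in(0,\infty): G(x)_N<0\text{ and }y_{B_a}>0\text{ for all }(x,y)\in\mathbf B^P_t(z^\star)\}$ (if $\delta=\infty$ the ball of radius $\delta/2$ is the whole space), $\mathcal D=\mathcal S^\star+\tau\mathbf B$, $\mathcal D_\delta=\mathcal D\cap\mathbf B^P_{\delta/2}(z^\star)$, and $\alpha_{\mathcal M}=\inf_{z\in\mathcal D_\delta\cap\mathcal M}\operatorname{dist}_2(0,\mathcal F(z))/\operatorname{dist}_2(z,\mathcal S^\star)$ (infimum over $z\notin\mathcal S^\star$). *)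

(* Defs.v *)
From mathcomp Require Import all_boot all_order all_algebra.
From mathcomp Require Import all_classical all_reals all_analysis.

Set Implicit Arguments.
Unset Strict Implicit.
Unset Printing Implicit Defensive.

Import Order.TTheory GRing.Theory Num.Theory numFieldNormedType.Exports.

Local Open Scope classical_set_scope.
Local Open Scope ring_scope.

(* R^n is 'cV[R]_n, and z = (x, y) in R^n x R^m is the stacked column
   z : 'cV[R]_(n + m), with x = usubmx z and y = dsubmx z. *)

Section Euclidean.
Context {R : realType} {d : nat}.
Implicit Types (x y z u v : 'cV[R]_d) (M : 'M[R]_d) (Q : set 'cV[R]_d).

Definition dot u v : R := \sum_i u i 0 * v i 0.

Definition norm2 z : R := Num.sqrt (dot z z).

Definition posdefmx M : Prop :=
  M^T = M /\ forall z, z != 0 -> 0 < (z^T *m M *m z) 0 0.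

Definition normM M z : R := Num.sqrt ((z^T *m M *m z) 0 0).

(* +oo when Q is empty *)
Definition dist2 z Q : \bar R := ereal_inf [set (norm2 (z - q))%:E | q in Q].

Definition distM M z Q : \bar R :=
  ereal_inf [set (normM M (z - q))%:E | q in Q].

(* the whole space when t = +oo *)
Definition ballM M (t : \bar R) z : set 'cV[R]_d :=
  [set w | ((normM M (w - z))%:E < t)%E].

Definition unit_ball : set 'cV[R]_d := [set b | norm2 b < 1].

(* Q + t B *)
Definition thicken Q (t : R) : set 'cV[R]_d :=
  [set q + t *: b | q in Q & b in unit_ball].

Definition lambda_max M : R := sup [set a : R | eigenvalue M a].

Definition convex_fun (f : 'cV[R]_d -> R) : Prop :=
  convex_function (E := 'cV[R]_d) setT f.

Definition subdiff (f : 'cV[R]_d -> R) x : set 'cV[R]_d :=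
  [set v | forall u, f x + dot v (u - x) <= f u].

Definition nonneg_orthant : set 'cV[R]_d := [set y | forall i, 0 <= y i 0].

Definition normal_cone (C : set 'cV[R]_d) y : set 'cV[R]_d :=
  [set v | C y /\ forall u, C u -> dot v (u - y) <= 0].

End Euclidean.

Section ConvexProgram.
Context {R : realType} {n m : nat}.
Variables (f : 'cV[R]_n -> R) (g : 'I_m -> 'cV[R]_n -> R).
Implicit Types (x : 'cV[R]_n) (y : 'cV[R]_m) (z : 'cV[R]_(n + m)).

Definition constraint_map x : 'cV[R]_m := \col_j g j x.

Definition dual_fun y : \bar R :=
  ereal_inf (range (fun x => (f x + dot y (constraint_map x))%:E)).

Definition solutions : set 'cV[R]_(n + m) :=
  [set z | [/\ ((f (usubmx z))%:E - dual_fun (dsubmx z) <= 0)%E,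
               forall j, g j (usubmx z) <= 0
             & nonneg_orthant (dsubmx z)]].

(* (df(x) + sum_j y_j dg_j(x)) x (- G(x) + N(y)), and set0 unless y >= 0 *)
Definition saddle_subdiff z : set 'cV[R]_(n + m) :=
  let x := usubmx z in
  let y := dsubmx z in
  [set w | [/\ nonneg_orthant y,
      exists v0 (v : 'I_m -> 'cV[R]_n),
        [/\ subdiff f x v0, forall j, subdiff (g j) x (v j)
          & usubmx w = v0 + \sum_j y j 0 *: v j]
    & exists2 u, normal_cone nonneg_orthant y u
        & dsubmx w = - constraint_map x + u]].

Definition metric_subregular : Prop :=
  forall t : R, 0 < t -> exists2 alpha : R, 0 < alpha &
    forall z, thicken solutions t z ->
      (alpha%:E * dist2 z solutions <= dist2 0 (saddle_subdiff z))%E.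

(* step z^k is the pair (main iterate, auxiliary iterate) of index k + 1 *)
Definition main_iterate (step : 'cV[R]_(n + m) ->
    'cV[R]_(n + m) * 'cV[R]_(n + m)) z0 (k : nat) : 'cV[R]_(n + m) :=
  iter k (fun z => (step z).1) z0.

Definition subdiff_rate (step : 'cV[R]_(n + m) ->
    'cV[R]_(n + m) * 'cV[R]_(n + m)) (P : 'M[R]_(n + m)) (gamma : R) : Prop :=
  forall z0 (k : nat), (1 <= k)%N ->
    (distM (invmx P) 0 (saddle_subdiff (main_iterate step z0 k)) <=
     gamma%:E * distM P z0 solutions * ((Num.sqrt k%:R)^-1)%:E)%E.

Section LocalConstants.
Variables (P : 'M[R]_(n + m)) (tau : R) (zs : 'cV[R]_(n + m)).

Definition inactive : set 'I_m := [set j | g j (usubmx zs) < 0].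

Definition strictly_active : set 'I_m :=
  [set j | g j (usubmx zs) = 0 /\ 0 < dsubmx zs j 0].

Definition manifold : set 'cV[R]_(n + m) :=
  [set z | [/\ nonneg_orthant (dsubmx z),
               forall j, inactive j -> g j (usubmx z) < 0,
               forall j, inactive j -> dsubmx z j 0 = 0
             & forall j, strictly_active j -> 0 < dsubmx z j 0]].

Definition delta_radius : \bar R :=
  ereal_sup [set t%:E | t in [set t : R | 0 < t /\
    forall z, ballM P t%:E zs z ->
      (forall j, inactive j -> g j (usubmx z) < 0) /\
      (forall j, strictly_active j -> 0 < dsubmx z j 0)]].

Definition D_delta : set 'cV[R]_(n + m) :=
  thicken solutions tau `&` ballM P (delta_radius * (2^-1)%:E)%E zs.

Definition alpha_manifold : \bar R :=
  ereal_inf [set (dist2 0 (saddle_subdiff z) / dist2 z solutions)%E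
            | z in (D_delta `&` manifold) `\` solutions].

(* alpha_manifold is positive under metric subregularity; it is +oo, and
   nu_manifold is then 0, exactly when the infimum ranges over no point at which
   the ratio is finite. *)
Definition nu_manifold (gamma : R) : R :=
  fine ((gamma * lambda_max P)%:E / alpha_manifold)%E.

End LocalConstants.

End ConvexProgram.

(* Main.v *)
Require Import Defs.
From mathcomp Require Import all_boot all_order all_algebra ring lra.
From mathcomp Require Import all_classical all_reals all_analysis.
Import Order.TTheory GRing.Theory Num.Theory numFieldNormedType.Exports.
Local Open Scope classical_set_scope.
Local Open Scope ring_scope.

(** The argument is a restart argument.  Write [r j] for the Euclidean distance
    from the iterate of index [K + j] to the solution set S, and [lam] for
    [lambda_max P].

    One step.  The rate condition holds from every initial point, so it may be
    restarted at any iterate [w]: after [k] steps it bounds the distance from 0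
    to the saddle subdifferential F at the new iterate [z], measured in the norm
    of P^-1, by gamma / sqrt k times the P-distance of [w] to S.  Passing to
    Euclidean norms costs a factor [sqrt lam] on either side
    ([normM_le_norm2], [norm2_le_normM_inv]).  By definition of alpha_M as an
    infimum of ratios, alpha_M dist(z, S) <= dist(0, F z) as long as [z] lies in
    the identified region.  Together,
    r (j + k) <= (nu / sqrt k) r j  ([dist2_solutions_contract]).

    Restart.  With N the ceiling of e nu^2 one has nu / sqrt N <= e^(-1/2), so
    every block of N steps gains that factor; the one-step bound used once more
    on the last, partial block gives the exponential estimate
    ([restart_linear_rate]).

    Two facts need a proof of their own.  Since [lambda_max] is a supremum of
    eigenvalues, z^T P z <= lam |z|^2 says that the largest value of the Rayleigh
    quotient is an eigenvalue ([quad_form_le_lambda_max]).  And the ratio in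
    alpha_M behaves like a quotient of reals only where dist(z, S) > 0: outside S
    this holds because S is closed, which rests on the continuity of finite
    convex functions ([convex_fun_continuous], [closed_solutions]).  Metric
    subregularity then makes alpha_M positive, and if alpha_M is infinite, so
    that nu = 0, the identified iterates all lie in S, because the rate condition
    makes dist(0, F z) finite. *)

Set Implicit Arguments.
Unset Strict Implicit.
Unset Printing Implicit Defensive.

(** * Quadratic forms and the largest eigenvalue *)

Section QuadraticForms.
Context {R : realType} {d : nat}.
Implicit Types (u v w z : 'cV[R]_d) (A B M : 'M[R]_d).

Lemma dotE u v : dot u v = (u^T *m v) 0 0.
Proof. by rewrite mxE; apply: eq_bigr => i _; rewrite mxE. Qed.

Lemma dotC u v : dot u v = dot v u.
Proof. by apply: eq_bigr => i _; rewrite mulrC. Qed.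

Lemma dotDl u v w : dot (u + v) w = dot u w + dot v w.
Proof. by rewrite -big_split; apply: eq_bigr => i _; rewrite mxE mulrDl. Qed.

Lemma dotZl a u v : dot (a *: u) v = a * dot u v.
Proof. by rewrite mulr_sumr; apply: eq_bigr => i _; rewrite mxE mulrA. Qed.

Lemma dotDr u v w : dot u (v + w) = dot u v + dot u w.
Proof. by rewrite dotC dotDl !(dotC u). Qed.

Lemma dotZr a u v : dot u (a *: v) = a * dot u v.
Proof. by rewrite dotC dotZl (dotC u). Qed.

Lemma dotNr u v : dot u (- v) = - dot u v.
Proof. by rewrite -scaleN1r dotZr mulN1r. Qed.

Lemma dot_ge0 u : 0 <= dot u u.
Proof. by apply: sumr_ge0 => i _; rewrite -expr2 sqr_ge0. Qed.

Lemma dot_gt0 u : u != 0 -> 0 < dot u u.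
Proof.
move=> u0; rewrite lt_def dot_ge0 andbT; apply: contraNneq u0 => /eqP.
rewrite psumr_eq0; last by move=> i _; rewrite -expr2 sqr_ge0.
move/allP => u0; apply/eqP/matrixP => i j; rewrite ord1 mxE.
have := u0 i (mem_index_enum i); rewrite -expr2 sqrf_eq0 => /eqP.
by [].
Qed.

Lemma dot_mulmxr A u v : dot u (A *m v) = dot (A^T *m u) v.
Proof. by rewrite !dotE trmx_mul trmxK mulmxA. Qed.

Lemma quad_formE M z : (z^T *m M *m z) 0 0 = dot z (M *m z).
Proof. by rewrite dotE mulmxA. Qed.

Lemma quad_form_bounded A :
  exists2 C : R, 0 < C & forall z, dot z (A *m z) <= C * dot z z.
Proof.
exists (1 + \sum_i \sum_j `|A i j|).
  by rewrite ltr_wpDr// sumr_ge0 // => i _; rewrite sumr_ge0.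
have le_sq z i : z i 0 ^+ 2 <= dot z z.
  rewrite /dot (bigD1 i)//= expr2 lerDl sumr_ge0 // => j _.
  by rewrite -expr2 sqr_ge0.
move=> z; rewrite mulrDl mul1r; apply: ler_wpDl; first exact: dot_ge0.
rewrite mulr_suml; apply: ler_sum => i _.
rewrite mxE mulr_sumr mulr_suml; apply: ler_sum => j _.
apply: (le_trans (ler_norm _)); rewrite !normrM mulrCA ler_wpM2l//.
have hi := le_sq z i; have hj := le_sq z j.
have := sqr_ge0 (`|z i 0| - `|z j 0|).
rewrite sqrrB !real_normK ?num_real//; lra.
Qed.

(** A semidefinite form is nonnegative at v - C^-1 A v; expanding it there and
    bounding the quadratic term by C |A v|^2 gives the inequality. *)
Lemma psd_mulmx_le A (C : R) v : A^T = A -> 0 < C ->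
    (forall z, 0 <= dot z (A *m z)) ->
    (forall z, dot z (A *m z) <= C * dot z z) ->
  dot (A *m v) (A *m v) <= C * dot v (A *m v).
Proof.
move=> As C0 psd ub; set w := A *m v.
have := psd (v - C^-1 *: w); have := ub w.
rewrite -scaleNr mulmxDr -scalemxAr dotDl !dotDr !dotZl !dotZr.
rewrite [dot v (A *m w)]dot_mulmxr As -/w.
set a := dot w w; set b := dot w (A *m w).
set c := dot v w => h1 h2.
have E : C * C^-1 = 1 by rewrite divff ?gt_eqF.
have i0 : 0 < C^-1 by rewrite invr_gt0.
set i := C^-1 in E i0 h2.
have : 0 <= C * (c + - i * a + (- i * a + - i * (- i * b))).
  by apply: mulr_ge0; [exact: ltW|move: h2; congr (_ <= _); lra].
have -> : C * (c + - i * a + (- i * a + - i * (- i * b)))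
   = C * c - 2 * (C * i) * a + (C * i) * i * b by ring.
rewrite E => h3.
have : i * b <= i * (C * a) by rewrite ler_wpM2l// ltW.
have -> : i * (C * a) = (C * i) * a by ring.
rewrite E; lra.
Qed.

(** The smallest mu with z^T M z <= mu |z|^2 for all z is an eigenvalue.  If
    A = mu I - M, which is positive semidefinite, were invertible, then |u|^2
    would be at most D |A u|^2 <= C D u^T A u, and mu could be lowered by
    (C D)^-1.  This yields the variational characterization without compactness
    of the sphere or the spectral theorem. *)
Lemma quad_form_le_lambda_max M z : M^T = M ->
  dot z (M *m z) <= lambda_max M * dot z z.
Proof.
move=> Ms; have [->|z0] := eqVneq z 0.
  by rewrite mulmx0 !dotE mulmx0 !mxE mulr0.
have zz := dot_gt0 z0.
pose E := [set c : R | forall u, dot u (M *m u) <= c * dot u u].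
have [C0 C0_gt0 EC0] := quad_form_bounded M.
have lbE u : u != 0 -> lbound E (dot u (M *m u) / dot u u).
  by move=> u0 c Ec; rewrite ler_pdivrMr ?dot_gt0//; exact: Ec.
have infE : has_inf E.
  by split; [exists C0 | exists (dot z (M *m z) / dot z z); exact: lbE].
set mu := inf E.
have Emu : E mu.
  move=> u; have [->|u0] := eqVneq u 0.
    by rewrite mulmx0 !dotE mulmx0 !mxE mulr0.
  rewrite -ler_pdivrMr ?dot_gt0//; apply: lb_le_inf; first by case: infE.
  exact: lbE.
have mu_max a : eigenvalue M a -> a <= mu.
  move=> /eigenvalueP[v vM v0].
  have v0' : v^T != 0 by rewrite -trmx0 (inj_eq trmx_inj).
  have Mv : M *m v^T = a *: v^T by rewrite -{1}Ms -trmx_mul vM linearZ.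
  by have := Emu v^T; rewrite Mv dotZr ler_pM2r ?dot_gt0.
suff eig : eigenvalue M mu.
  apply: le_trans (Emu z) _; rewrite ler_pM2r //.
  by apply: ub_le_sup => //; exists mu.
pose A := mu%:M - M.
have As : A^T = A by rewrite /A linearB/= tr_scalar_mx Ms.
have AE u : dot u (A *m u) = mu * dot u u - dot u (M *m u).
  by rewrite mulmxBl mul_scalar_mx dotDr dotNr dotZr.
have psd u : 0 <= dot u (A *m u) by rewrite AE subr_ge0; exact: Emu.
have [Au|Anu] := boolP (A \in unitmx); last first.
  apply: contraNT Anu => /negPn/eqP ker0; rewrite -row_free_unit.
  apply: inj_row_free => v; rewrite mulmxBr mul_mx_scalar => /eqP.
  rewrite subr_eq0 => /eqP vM; apply/eqP; rewrite -submx0 -ker0.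
  exact/eigenspaceP.
have [C C_gt0 ubA] := quad_form_bounded A.
have [D D_gt0 ubI] := quad_form_bounded ((invmx A)^T *m invmx A).
have : E (mu - (C * D)^-1).
  move=> u; have h1 := psd_mulmx_le u As C_gt0 psd ubA.
  have := ubI (A *m u).
  rewrite -mulmxA mulKmx// [dot (A *m u) (_ *m u)]dot_mulmxr trmxK mulKmx//.
  move=> h2; rewrite mulrBl.
  have : dot u u <= D * C * dot u (A *m u).
    by apply: (le_trans h2); rewrite -mulrA ler_wpM2l// ltW.
  rewrite AE -ler_pdivrMl ?mulr_gt0// [D * C]mulrC; lra.
move/(ge_inf infE.2); rewrite -/mu.
have : 0 < (C * D)^-1 by rewrite invr_gt0 mulr_gt0.
lra.
Qed.

End QuadraticForms.

Section WeightedNorms.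
Context {R : realType} {d : nat}.
Implicit Types (z w : 'cV[R]_d) (P : 'M[R]_d).

Lemma posdefmx_unit P : posdefmx P -> P \in unitmx.
Proof.
move=> [Ps Ppos]; rewrite -row_free_unit; apply: inj_row_free => v vP.
apply/eqP; apply/negPn/negP => v0.
have : v^T != 0 by rewrite -trmx0 (inj_eq trmx_inj).
by move/Ppos; rewrite trmxK vP mul0mx mxE ltxx.
Qed.

Lemma lambda_max_gt0 P z : posdefmx P -> z != 0 -> 0 < lambda_max P.
Proof.
move=> [Ps Ppos] z0; have := Ppos _ z0; rewrite quad_formE.
move=> /lt_le_trans /(_ (quad_form_le_lambda_max z Ps)).
by rewrite pmulr_lgt0// dot_gt0.
Qed.

Lemma normM_le_norm2 P z : posdefmx P -> 0 < lambda_max P ->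
  normM P z <= Num.sqrt (lambda_max P) * norm2 z.
Proof.
move=> [Ps _] l0; rewrite /normM /norm2 -sqrtrM ?(ltW l0)// ler_wsqrtr//.
rewrite quad_formE.
exact: quad_form_le_lambda_max.
Qed.

(** With z = P u this reads |P u|^2 <= lambda_max P * u^T P u, an instance of
    [psd_mulmx_le]. *)
Lemma norm2_le_normM_inv P z : posdefmx P -> 0 < lambda_max P ->
  norm2 z <= Num.sqrt (lambda_max P) * normM (invmx P) z.
Proof.
move=> Pp l0; have [Ps Ppos] := Pp; have Pu := posdefmx_unit Pp.
rewrite /normM /norm2 -sqrtrM ?(ltW l0)// ler_wsqrtr// quad_formE.
have := @psd_mulmx_le _ _ P (lambda_max P) (invmx P *m z) Ps l0.
rewrite mulKVmx// (dotC z); apply.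
  move=> u; have [->|/Ppos] := eqVneq u 0.
    by rewrite mulmx0 dotE mulmx0 mxE.
  by rewrite quad_formE => /ltW.
by move=> u; exact: quad_form_le_lambda_max.
Qed.

Lemma coord_le_norm2 z i : `|z i 0| <= norm2 z.
Proof.
rewrite -sqrtr_sqr ler_wsqrtr// /dot (bigD1 i)//= expr2 lerDl.
by apply: sumr_ge0 => j _; rewrite -expr2 sqr_ge0.
Qed.

End WeightedNorms.

Lemma ereal_inf_le_scale {R : realType} {T : Type} (Q : set T) (F G : T -> R)
    (c : R) : 0 < c -> (forall w, Q w -> F w <= c * G w) ->
  (ereal_inf [set (F w)%:E | w in Q] <=
   c%:E * ereal_inf [set (G w)%:E | w in Q])%E.
Proof.
move=> c0 FG; rewrite -ereal_inf_pZl//; apply: le_ereal_inf_tmp => _ [_ [w Qw <-] <-].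
by apply: ge_ereal_inf; exists (F w)%:E; [exists w|rewrite lee_fin FG].
Qed.

(** * Continuity of finite convex functions *)

Section Convex.
Context {R : realType} {d : nat}.
Implicit Types (f : 'cV[R]_d -> R) (x y u : 'cV[R]_d).

Lemma convex_funP f x y (t : R) : convex_fun f -> 0 <= t -> t <= 1 ->
  f (t *: x + (1 - t) *: y) <= t * f x + (1 - t) * f y.
Proof.
move=> cf t0 t1; have := cf (Itv01 t0 t1) x y.
rewrite !in_setE => /(_ I I).
by rewrite convRE.
Qed.

Lemma convex_fun_shift f x : convex_fun f ->
  forall (t : R) u v, 0 <= t -> t <= 1 ->
  f (x + (t *: u + (1 - t) *: v)) - f x <=
   t * (f (x + u) - f x) + (1 - t) * (f (x + v) - f x).
Proof.
move=> cf t u v t0 t1.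
have -> : x + (t *: u + (1 - t) *: v) = t *: (x + u) + (1 - t) *: (x + v).
  rewrite !scalerDr addrACA -scalerDl.
  by rewrite subrKC scale1r.
have := convex_funP (x + u) (x + v) cf t0 t1; lra.
Qed.

Lemma convex_fun_ub_line f x u : convex_fun f ->
  exists2 C : R, 0 <= C &
    forall c : R, `|c| <= 1 -> f (x + c *: u) - f x <= C * `|c|.
Proof.
move=> cf.
exists (`|f (x + u) - f x| + `|f (x - u) - f x|) => [|c c1].
  by rewrite addr_ge0.
have H (v : 'cV[R]_d) (t : R) : 0 <= t -> t <= 1 ->
    f (x + t *: v) - f x <= t * `|f (x + v) - f x|.
  move=> t0 t1; have := convex_fun_shift x cf v 0 t0 t1.
  rewrite scaler0 !addr0 subrr mulr0 addr0 => /le_trans; apply.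
  by rewrite ler_wpM2l// ler_norm.
have [c0|c0] := leP 0 c.
  have := H u c c0; rewrite ger0_norm// in c1 *.
  move/(_ c1)/le_trans; apply; rewrite mulrC ler_wpM2r//.
  by rewrite lerDl.
have := H (- u) (- c); rewrite scalerN scaleNr opprK ltr0_norm// in c1 *.
rewrite oppr_ge0 => /(_ (ltW c0) c1)/le_trans; apply.
rewrite mulrC ler_wpM2r ?lerDr//.
by rewrite oppr_ge0 ltW.
Qed.

(** The half-half split of convexity reduces a sum of vectors to its summands,
    one of which is handled along a line; each split doubles the coefficients,
    whence the halving of the radius. *)
Lemma convex_fun_ub_span f x (I : Type) (s : seq I) (e : I -> 'cV[R]_d) :
  convex_fun f ->
  exists r C : R, [/\ 0 < r, 0 <= C &
    forall (c : I -> R) eta, 0 <= eta -> eta <= r ->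
    (forall i, `|c i| <= eta) ->
    f (x + \sum_(i <- s) c i *: e i) - f x <= C * eta].
Proof.
move=> cf; elim: s => [|i s [r [C [r0 C0 IH]]]].
  by exists 1, 0; split=> // c eta _ _ _; rewrite big_nil addr0 subrr mul0r.
have [M M0 HM] := convex_fun_ub_line x (e i) cf.
exists (Num.min (r / 2) (1 / 2)), (M + C); split.
- by rewrite lt_min !divr_gt0.
- exact: addr_ge0.
move=> c eta eta0; rewrite le_min => /andP[er e1] ce.
rewrite big_cons.
have h : 0 <= (1 / 2 : R) by rewrite divr_ge0.
have h' : (1 / 2 : R) <= 1 by rewrite ler_pdivrMr// mul1r ler1n.
have := convex_fun_shift x cf ((2 * c i) *: e i)
  (2 *: \sum_(j <- s) c j *: e j) h h'.
have e2 : 1 - 1 / 2 = 1 / 2 :> R by field.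
have e3 (a : R) : 1 / 2 * (2 * a) = a by field.
have e4 : 1 / 2 * 2 = 1 :> R by field.
rewrite e2 !scalerA e3 e4 scale1r => /le_trans; apply.
have c2 : `|2 * c i| <= 2 * eta by rewrite normrM ger0_norm// ler_wpM2l.
have := HM (2 * c i); rewrite (le_trans c2); last by lra.
move=> /(_ isT) h1.
have h3 : f (x + 2 *: (\sum_(j <- s) c j *: e j)) - f x <= C * (2 * eta).
  rewrite scaler_sumr; under eq_bigr do rewrite scalerA.
  apply: IH; [by rewrite mulr_ge0|lra|move=> j].
  by rewrite normrM ger0_norm// ler_wpM2l.
have h4 : M * `|2 * c i| <= M * (2 * eta) by rewrite ler_wpM2l.
lra.
Qed.

(** Near x, [convex_fun_ub_span] on the standard basis bounds f (x + u) - f x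
    from above by a multiple of the size of u; the midpoint inequality at x
    between x + u and x - u turns the bound at - u into the lower bound at u. *)
Lemma convex_fun_continuous f : convex_fun f -> continuous f.
Proof.
move=> cf x.
have [r [C [r0 C0 ub]]] := convex_fun_ub_span x (index_enum 'I_d)
  (fun i => delta_mx i 0) cf.
have sumE u : u = \sum_i u i 0 *: delta_mx i 0.
  by rewrite [LHS]matrix_sum_delta; apply: eq_bigr => i _; rewrite big_ord1.
have bnd u eta : 0 <= eta -> eta <= r -> (forall i, `|u i 0| <= eta) ->
    `|f (x + u) - f x| <= C * eta.
  move=> e0 er ue; rewrite ler_norml; apply/andP; split; last first.
    by rewrite [u]sumE; apply: ub.
  have : f (x - u) - f x <= C * eta.
    by rewrite [- u]sumE; apply: ub => // i; rewrite mxE normrN.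
  have h0 : 0 <= (1 / 2 : R) by rewrite divr_ge0.
  have h1 : (1 / 2 : R) <= 1 by rewrite ler_pdivrMr// mul1r ler1n.
  have := convex_fun_shift x cf u (- u) h0 h1.
  have e2 : 1 - 1 / 2 = 1 / 2 :> R by field.
  rewrite e2 scalerN subrr addr0 subrr; lra.
apply/(@cvgrPdist_le _ _ _ (nbhs x)) => e e0.
pose eta := Num.min r (e / (C + 1)).
have C1 : 0 < C + 1 by lra.
have eta0 : 0 < eta by rewrite lt_min r0 divr_gt0.
have etae : C * eta <= e.
  apply: (@le_trans _ _ ((C + 1) * eta)).
    by rewrite ler_wpM2r ?lerDl// ltW.
  by rewrite -ler_pdivlMl// mulrC ge_min lexx orbT.
apply/nbhs_ballP; exists eta => // y [_ xy].
rewrite distrC -[y](subrKC x); apply: le_trans etae.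
apply: bnd; [exact: ltW|by rewrite ge_min lexx|] => i.
by have := xy i 0; rewrite !mxE /ball/= distrC => /ltW.
Qed.

End Convex.

(** * Closedness of the solution set *)

Lemma closed_dist2_gt0 {R : realType} {d : nat} (Q : set 'cV[R]_d) z :
  closed Q -> ~ Q z -> (0 < dist2 z Q)%E.
Proof.
move=> cQ nQz; rewrite ltNge; apply/negP => d0; apply/nQz/cQ => B.
move=> /nbhs_ballP[e /= e0 eB].
have : (dist2 z Q < e%:E)%E by rewrite (le_lt_trans d0)// lte_fin.
move=> /ereal_inf_lt[_ [q Qq <-]]; rewrite lte_fin => zqe.
exists q; split=> //; apply: eB; split=> // i j; rewrite ord1 /ball/=.
apply: le_lt_trans zqe; have := coord_le_norm2 (z - q) i.
by rewrite !mxE.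
Qed.

Lemma closed_le_continuous {R : realType} (T : topologicalType) (h1 h2 : T -> R) :
  continuous h1 -> continuous h2 -> closed [set z | h1 z <= h2 z].
Proof.
move=> c1 c2.
have -> : [set z | h1 z <= h2 z] = (fun z => h2 z - h1 z) @^-1` [set y | 0 <= y].
  by apply/seteqP; split=> z /=; rewrite subr_ge0.
apply: closed_comp; last exact: closed_ge.
by move=> z _; apply: cvgB; [exact: c2|exact: c1].
Qed.

Section Solutions.
Context {R : realType} {n m : nat}.
Variables (f : 'cV[R]_n -> R) (g : 'I_m -> 'cV[R]_n -> R).
Implicit Types z : 'cV[R]_(n + m).

(** The condition f(x) <= h(y) involves an infimum, so it is the conjunction of
    one inequality for each point of that infimum.  This exhibits the solution
    set as an intersection of sublevel sets of continuous functions. *)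
Lemma solutionsE : solutions f g =
  \bigcap_(x in setT)
    [set z | f (usubmx z) <= f x + dot (dsubmx z) (constraint_map g x)] `&`
  \bigcap_(j in setT) [set z | g j (usubmx z) <= 0] `&`
  \bigcap_(j in setT) [set z | 0 <= dsubmx z j 0].
Proof.
apply/seteqP; split => z.
  move=> [fh gz yz]; split; last by move=> j _; exact: yz.
  split; last by move=> j _; exact: gz.
  move=> x _ /=; rewrite -lee_fin.
  apply: (@le_trans _ _ (dual_fun f g (dsubmx z))); last first.
    by apply: ereal_inf_lbound; exists x.
  move: fh; case: dual_fun => [r| |] //; last by rewrite leey.
  by move=> fh; rewrite lee_fin -subr_le0 -lee_fin; exact: fh.
move=> [[fx gz] yz]; split; [|by move=> j; exact: gz|by move=> j; exact: yz].
have : ((f (usubmx z))%:E <= dual_fun f g (dsubmx z))%E.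
  by apply: le_ereal_inf_tmp => _ [x _ <-]; rewrite lee_fin; exact: fx.
case: dual_fun => [r| |] //; last by move=> _; exact: leNye.
by rewrite lee_fin -subr_le0 -lee_fin => fr; exact: fr.
Qed.

Lemma usubmx_continuous : continuous (@usubmx R n m 1).
Proof.
move=> z A /nbhs_ballP[e /= e0 eA]; apply/nbhs_ballP.
exists e => // w [_ zw]; apply: eA.
by split=> // i j; rewrite !mxE; exact: zw.
Qed.

Lemma dsubmx_coord_continuous (j : 'I_m) : continuous (fun z => dsubmx z j 0 : R).
Proof.
have -> : (fun z => dsubmx z j 0 : R) = (fun z => z (rshift n j) 0).
  by apply/funext => z; rewrite mxE.
exact: coord_continuous.
Qed.

Lemma closed_solutions : convex_fun f -> (forall j, convex_fun (g j)) ->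
  closed (solutions f g).
Proof.
move=> cf cg; rewrite solutionsE.
have cu (h : 'cV[R]_n -> R) : convex_fun h ->
    continuous (fun z : 'cV[R]_(n + m) => h (usubmx z)).
  move=> /convex_fun_continuous ch z.
  by apply: continuous_comp; [exact: usubmx_continuous|exact: ch].
have c0 (c : R) : continuous (fun _ : 'cV[R]_(n + m) => c).
  by move=> z; exact: cst_continuous.
have cd (c : 'cV[R]_m) :
    continuous (fun z : 'cV[R]_(n + m) => dot (dsubmx z) c).
  apply: (@continuous_big _ _ +%R) => [x|j _]; first exact: add_continuous.
  by move=> z; exact: cvgM (@dsubmx_coord_continuous j z) (c0 (c j 0) z).
apply: closedI; [apply: closedI|]; apply: closed_bigI => i _.
- apply: closed_le_continuous; first exact: cu.
  by move=> z; exact: cvgD (c0 (f i) z) (cd (constraint_map g i) z).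
- by apply: closed_le_continuous; [exact: cu|exact: c0].
- by apply: closed_le_continuous; [exact: c0|exact: dsubmx_coord_continuous].
Qed.

End Solutions.

(** * The contraction estimate and the restart argument *)

Lemma lambda_max_ge0 {R : realType} {d : nat} (P : 'M[R]_d) :
  posdefmx P -> 0 <= lambda_max P.
Proof.
move=> Pp; have [[z z0]|nz] := pselect (exists z : 'cV[R]_d, z != 0).
  exact/ltW/(lambda_max_gt0 Pp z0).
(* In dimension 0 there is no eigenvalue and the supremum is 0 by convention. *)
rewrite /lambda_max; suff -> : [set a | eigenvalue P a] = set0 by rewrite sup0.
apply/seteqP; split=> // a /eigenvalueP[v _ v0]; apply: nz.
by exists v^T; rewrite -trmx0 (inj_eq trmx_inj).
Qed.

Lemma dist2_ge0 {R : realType} {d : nat} (z : 'cV[R]_d) Q : (0 <= dist2 z Q)%E.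
Proof.
by apply: le_ereal_inf_tmp => _ [q _ <-]; rewrite lee_fin sqrtr_ge0.
Qed.

Lemma dist2_fin_num {R : realType} {d : nat} (z : 'cV[R]_d) Q :
  Q !=set0 -> dist2 z Q \is a fin_num.
Proof.
move=> [q Qq]; rewrite ge0_fin_numE ?dist2_ge0//.
apply: (@le_lt_trans _ _ (norm2 (z - q))%:E); last exact: ltry.
by apply: ereal_inf_lbound; exists q.
Qed.

Lemma dist2_eq0 {R : realType} {d : nat} (z : 'cV[R]_d) (Q : set 'cV[R]_d) :
  Q z -> dist2 z Q = 0%E.
Proof.
move=> Qz; apply/eqP; rewrite eq_le dist2_ge0 andbT.
apply: ge_ereal_inf; exists (norm2 (z - z))%:E; first by exists z.
by rewrite subrr /norm2 dotE mulmx0 mxE sqrtr0.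
Qed.

Lemma main_iterateD {R : realType} {n m : nat} (step : 'cV[R]_(n + m) ->
    'cV[R]_(n + m) * 'cV[R]_(n + m)) z0 j k :
  main_iterate step z0 (j + k) = main_iterate step (main_iterate step z0 j) k.
Proof. by rewrite (addnC j) /main_iterate iterD. Qed.

Section OneStep.
Context {R : realType} {n m : nat}.
Variables (f : 'cV[R]_n -> R) (g : 'I_m -> 'cV[R]_n -> R).
Variables (P : 'M[R]_(n + m)) (gamma tau : R) (zs : 'cV[R]_(n + m)).
Hypotheses (f_convex : convex_fun f) (g_convex : forall j, convex_fun (g j)).
Hypotheses (S_nonempty : solutions f g !=set0) (P_posdef : posdefmx P).
Implicit Types z w : 'cV[R]_(n + m).
Local Notation S := (solutions f g).
Local Notation F := (saddle_subdiff f g).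
Local Notation alpha := (alpha_manifold f g P tau zs).
Local Notation nu := (nu_manifold f g P tau zs gamma).

Lemma dist2_solutions_gt0 z : ~ S z ->
  exists2 r : R, 0 < r & dist2 z S = r%:E.
Proof.
move=> nSz; exists (fine (dist2 z S)); last by rewrite fineK// dist2_fin_num.
rewrite -lte_fin fineK ?dist2_fin_num//.
exact: closed_dist2_gt0 (closed_solutions f_convex g_convex) nSz.
Qed.

(** Metric subregularity at radius tau supplies one constant for all of
    D_delta; it bounds every ratio from below, the divisor being a positive
    real number outside S. *)
Lemma alpha_manifold_gt0 : 0 < tau -> metric_subregular f g -> (0 < alpha)%E.
Proof.
move=> tau0 /(_ _ tau0)[a a0 sub]; apply: (@lt_le_trans _ _ a%:E) => //.
apply: le_ereal_inf_tmp => _ [z [[[Dz _] _] nSz] <-].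
have := sub z Dz; have [r r0 ->] := dist2_solutions_gt0 nSz.
by rewrite inver gt_eqF// lee_pdivlMr.
Qed.

Lemma alpha_manifold_mul_le z : (D_delta f g P tau zs `&` manifold g zs) z ->
  ~ S z -> (alpha * dist2 z S <= dist2 0 (F z))%E.
Proof.
move=> Dz nSz; have [r r0 rE] := dist2_solutions_gt0 nSz.
rewrite rE -lee_pdivlMr//; apply: ereal_inf_lbound; exists z => //.
by rewrite rE inver gt_eqF.
Qed.

Lemma nu_manifold_ge0 : 0 < gamma -> (0 <= alpha)%E -> 0 <= nu.
Proof.
move=> g0 a0; apply: fine_ge0; apply: mule_ge0; last by rewrite inve_ge0.
by rewrite lee_fin mulr_ge0 ?lambda_max_ge0// ltW.
Qed.

(** The rate condition restarted at w; each of the two passages between weighted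
    and Euclidean norms contributes a factor sqrt (lambda_max P). *)
Lemma dist2_subdiff_le step w k : 0 < lambda_max P -> 0 < gamma ->
    subdiff_rate f g step P gamma -> (1 <= k)%N ->
  (dist2 0 (F (main_iterate step w k)) <=
   (gamma * lambda_max P / Num.sqrt k%:R)%:E * dist2 w S)%E.
Proof.
move=> l0 g0 rate k1.
have sl0 : 0 < Num.sqrt (lambda_max P) by rewrite sqrtr_gt0.
have h1 : (dist2 0 (F (main_iterate step w k)) <= (Num.sqrt (lambda_max P))%:E *
    distM (invmx P) 0 (F (main_iterate step w k)))%E.
  by apply: ereal_inf_le_scale => // q _; exact: norm2_le_normM_inv.
have h2 : (distM P w S <= (Num.sqrt (lambda_max P))%:E * dist2 w S)%E.
  by apply: ereal_inf_le_scale => // q _; exact: normM_le_norm2.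
apply: (le_trans h1); apply: (le_trans (lee_wpmul2l _ (rate w k k1))).
  by rewrite lee_fin ltW.
have -> : ((gamma * lambda_max P / Num.sqrt k%:R)%:E * dist2 w S =
  (Num.sqrt (lambda_max P))%:E *
    (gamma%:E * ((Num.sqrt (lambda_max P))%:E * dist2 w S) *
   ((Num.sqrt k%:R)^-1)%:E))%E.
  rewrite -(fineK (dist2_fin_num w S_nonempty)) -!EFinM; congr EFin.
  by rewrite -[in LHS](sqr_sqrtr (ltW l0)); ring.
apply: lee_wpmul2l; first by rewrite lee_fin ltW.
apply: lee_wpmul2r; first by rewrite lee_fin invr_ge0 sqrtr_ge0.
by apply: lee_wpmul2l => //; rewrite lee_fin ltW.
Qed.

Lemma dist2_solutions_contract step w k :
    0 < gamma -> 0 < tau -> metric_subregular f g ->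
    subdiff_rate f g step P gamma -> (1 <= k)%N ->
    (D_delta f g P tau zs `&` manifold g zs) (main_iterate step w k) ->
  (dist2 (main_iterate step w k) S <= (nu / Num.sqrt k%:R)%:E * dist2 w S)%E.
Proof.
move=> g0 tau0 subreg rate k1; set z := main_iterate step w k => Dz.
have a0 := alpha_manifold_gt0 tau0 subreg.
have [Sz|nSz] := pselect (S z).
  rewrite dist2_eq0// mule_ge0 ?dist2_ge0// lee_fin divr_ge0 ?sqrtr_ge0//.
  exact: nu_manifold_ge0 (ltW a0).
(* A point outside S differs from some point of S, so the dimension is positive
   and lambda_max does not vanish. *)
have [s Ss] := S_nonempty.
have zs0 : z - s != 0.
  by rewrite subr_eq0; apply: contra_not_neq nSz => ->.
have l0 := lambda_max_gt0 P_posdef zs0.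
have := le_trans (alpha_manifold_mul_le Dz nSz)
  (dist2_subdiff_le w l0 g0 rate k1).
have [r r0 rE] := dist2_solutions_gt0 nSz.
rewrite -/z rE -(fineK (dist2_fin_num w S_nonempty)) -!EFinM /nu_manifold.
move: a0; case: alpha => [a| |]// a0.
- rewrite lte_fin in a0; rewrite inver gt_eqF// -!EFinM !lee_fin /= => h.
  rewrite -ler_pdivlMl// in h; apply: (le_trans h).
  by rewrite le_eqVlt; apply/orP; left; apply/eqP; ring.
(* Here alpha_M dist(z, S) = +oo, against the finiteness of dist(0, F z). *)
- by rewrite gt0_mulye ?lte_fin// leye_eq.
Qed.

End OneStep.

(** Blocks of N steps, N the ceiling of e nu^2, each contract by e^(-1/2).  An
    index k >= 1 is written q N + s with 1 <= s <= N: the last s steps cost nu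
    (as 1 / sqrt s <= 1), and q >= k / N - 1 accounts for the factor sqrt e. *)
Lemma restart_linear_rate {R : realType} (r : nat -> R) (nu : R) :
    (forall j, 0 <= r j) -> 0 <= nu ->
    (forall j k, (1 <= k)%N -> r (j + k)%N <= nu / Num.sqrt k%:R * r j) ->
  forall k, (1 <= k)%N ->
    r k <= Num.sqrt (expR 1) * nu *
      expR (- (1 / 2) * (k%:R / (Num.ceil (expR 1 * nu ^+ 2))%:~R)) * r 0%N.
Proof.
move=> r0 nu0 rate k k1.
have [nu_eq0|nun0] := eqVneq nu 0.
  (* The one-step bound already forces r k = 0. *)
  have := rate 0%N k k1; rewrite nu_eq0 mul0r mul0r add0n.
  by rewrite mulr0 !mul0r.
have nu_gt0 : 0 < nu by rewrite lt_def nun0.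
have en0 : 0 < expR 1 * nu ^+ 2 by rewrite mulr_gt0 ?expR_gt0 ?exprn_gt0.
have [N NE] : exists N : nat, Num.ceil (expR 1 * nu ^+ 2) = N%:Z.
  exists `|Num.ceil (expR 1 * nu ^+ 2)|%N; rewrite gez0_abs//.
  by rewrite ceil_ge0 (lt_trans _ en0).
have le_N : expR 1 * nu ^+ 2 <= N%:R.
  by have := ceil_ge (expR 1 * nu ^+ 2); rewrite NE.
rewrite NE -pmulrn.
have N_gt0 : (0 < N)%N by rewrite -(ltr0n R) (lt_le_trans en0).
have expRhalf : Num.sqrt (expR 1) = expR (1 / 2) :> R.
  have -> : expR 1 = expR (1 / 2) ^+ 2 :> R by rewrite expr2 -expRD -splitr.
  by rewrite sqrtr_sqr ger0_norm// expR_ge0.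
have block j : r (j + N)%N <= expR (- (1 / 2)) * r j.
  apply: (le_trans (rate j N N_gt0)); rewrite ler_wpM2r//.
  rewrite ler_pdivrMr ?sqrtr_gt0 ?ltr0n// expRN -expRhalf.
  rewrite ler_pdivlMl ?sqrtr_gt0 ?expR_gt0//.
  by rewrite -[nu]ger0_norm// -sqrtr_sqr -sqrtrM ?expR_ge0// ler_wsqrtr.
have blocks q : r (q * N)%N <= expR (- (1 / 2) * q%:R) * r 0%N.
  elim: q => [|q IH]; first by rewrite mul0n mulr0 expR0 mul1r.
  rewrite mulSn addnC; apply: (le_trans (block _)).
  rewrite -[q.+1%:R]natr1 mulrDr mulr1 expRD [expR _ * expR (- _)]mulrC -mulrA.
  by rewrite ler_wpM2l ?expR_ge0.
(* Dividing k - 1 rather than k keeps the last block nonempty. *)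
pose q := (k.-1 %/ N)%N; pose s := (k.-1 %% N).+1.
have kE : k = (q * N + s)%N by rewrite /s addnS -divn_eq prednK.
have s_le : (s <= N)%N by rewrite /s ltn_mod.
rewrite {1}kE; apply: (le_trans (rate _ _ _)) => //.
have sqs : 1 <= Num.sqrt s%:R :> R by rewrite -{1}sqrtr1 ler_wsqrtr// ler1n.
apply: (@le_trans _ _ (nu * (expR (- (1 / 2) * q%:R) * r 0%N))).
  apply: ler_pM => //; first by rewrite divr_ge0// sqrtr_ge0.
  by rewrite ler_piMr// invf_le1// (lt_le_trans ltr01).
rewrite mulrA ler_wpM2r// expRhalf mulrAC -expRD mulrC ler_wpM2r// ler_expR.
have : k%:R / N%:R <= q%:R + 1 :> R.
  rewrite ler_pdivrMr ?ltr0n// mulrDl mul1r {1}kE natrD natrM.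
  by rewrite lerD2l ler_nat.
lra.
Qed.

Theorem proposition4p4 (R : realType) (n m : nat)
    (f : 'cV[R]_n -> R) (g : 'I_m -> 'cV[R]_n -> R)
    (step : 'cV[R]_(n + m) -> 'cV[R]_(n + m) * 'cV[R]_(n + m))
    (P : 'M[R]_(n + m)) (gamma tau : R)
    (z0 zs : 'cV[R]_(n + m)) (K : nat)
    (f_convex : convex_fun f)
    (g_convex : forall j, convex_fun (g j))
    (S_nonempty : solutions f g !=set0)
    (subreg : metric_subregular f g)
    (P_posdef : posdefmx P)
    (gamma_gt0 : 0 < gamma)
    (tau_gt0 : 0 < tau)
    (rate : subdiff_rate f g step P gamma)
    (near_S : forall k : nat, (1 <= k)%N ->
       (dist2 (main_iterate step z0 k) (solutions f g) <= tau%:E)%E)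
    (zs_sol : solutions f g zs)
    (cvg_zs : main_iterate step z0 k @[k --> \oo] --> zs)
    (K_gt0 : (0 < K)%N)
    (identified : forall k : nat, (K < k)%N ->
       (D_delta f g P tau zs `&` manifold g zs) (main_iterate step z0 k)) :
  let nu := nu_manifold f g P tau zs gamma in
  forall k : nat, (1 <= k)%N ->
    (dist2 (main_iterate step z0 (k + K)) (solutions f g) <=
     (Num.sqrt (expR 1) * nu *
      expR (- (1 / 2) * (k%:R / (Num.ceil (expR 1 * nu ^+ 2))%:~R)))%:E *
     dist2 (main_iterate step z0 K) (solutions f g))%E.
Proof.
move=> nu k k1.
pose r j := fine (dist2 (main_iterate step z0 (j + K)) (solutions f g)).
have rE j : dist2 (main_iterate step z0 (j + K)) (solutions f g) = (r j)%:E.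
  by rewrite fineK// dist2_fin_num.
have nu0 : 0 <= nu.
  apply: nu_manifold_ge0 => //; apply: ltW.
  exact: alpha_manifold_gt0 f_convex g_convex S_nonempty tau_gt0 subreg.
rewrite rE -[K in X in (_ <= _ * X)%E]add0n rE -EFinM lee_fin.
apply: restart_linear_rate => // [j|j i i1].
  by rewrite fine_ge0// dist2_ge0.
rewrite -lee_fin EFinM -!rE addnAC main_iterateD.
apply: dist2_solutions_contract => //.
rewrite -main_iterateD; apply: identified.
by rewrite -addnA addnCA -[K.+1]addn1 leq_add2l (leq_trans i1)// leq_addl.
Qed.
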